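(* Let $a$ and $x$ be real numbers and let $\{a_n\}_{n\ge0}$, $\{b_n\}_{n\ge 0}$ be sequences of (real or complex) numbers. Then $$b_n=\sum_{k=0}^n\binom nk\Big((1-a)(-x)^k+\frac a2\big((1-x)^k+(-1-x)^k\big)\Big)a_{n-k}\ \text{ for all } n\ge 0$$ if and only if $$a_n=\sum_{k=0}^n\binom nk E_{k,a}(x)b_{n-k}\ \text{ for all } n\ge 0.$$
   Context: For a real number $a$, the sequence $\{E_{n,a}\}$ is defined by $E_{0,a}=1$ and $E_{n,a}=-a\sum_{k=1}^{\lfloor n/2\rfloor}\binom{n}{2k}E_{n-2k,a}$ for $n\ge 1$, and the polynomials $E_{n,a}(x)$ are defined by $E_{n,a}(x)=\sum_{k=0}^n\binom nk E_{k,a}x^{n-k}$ for $n\ge 0$. *)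

(* Defs.v *)
From HB Require Import structures.
From mathcomp Require Import all_boot all_order all_algebra.
From mathcomp Require Import reals.
From mathcomp Require Import complex.

Set Implicit Arguments.
Unset Strict Implicit.
Unset Printing Implicit Defensive.

Import Order.TTheory GRing.Theory Num.Theory.
Local Open Scope ring_scope.

(* The list [:: E_{0,a}; ...; E_{n,a}]: the recurrence for E_{n,a} refers to
   all the earlier terms of the same parity, so we carry them along. *)
Fixpoint Eseq (R : realType) (a : R) (n : nat) : seq R :=
  if n is m.+1 then
    let s := Eseq a m in
    rcons s (- a * \sum_(1 <= k < (m.+1)./2.+1)
                     'C(m.+1, 2 * k)%:R * s`_(m.+1 - 2 * k))
  else [:: 1].

Definition Enum (R : realType) (a : R) (n : nat) : R := (Eseq a n)`_n.

Definition Epoly (R : realType) (a : R) (n : nat) : {poly R} :=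
  \sum_(0 <= k < n.+1) ('C(n, k)%:R * Enum a k) *: 'X^(n - k).

Lemma size_Eseq (R : realType) (a : R) n : size (Eseq a n) = n.+1.
Proof. by elim: n => //= n IHn; rewrite size_rcons IHn. Qed.

Lemma nth_Eseq (R : realType) (a : R) n j :
  (j <= n)%N -> (Eseq a n)`_j = Enum a j.
Proof.
elim: n => [|n IHn]; first by rewrite leqn0 => /eqP ->.
rewrite leq_eqVlt => /orP[/eqP -> //|]; rewrite ltnS => lejn.
by rewrite /= nth_rcons size_Eseq ltnS lejn IHn.
Qed.

Lemma Enum0 (R : realType) (a : R) : Enum a 0 = 1.
Proof. by []. Qed.

Lemma Enum_rec (R : realType) (a : R) n : (1 <= n)%N ->
  Enum a n = - a * \sum_(1 <= k < n./2.+1) 'C(n, 2 * k)%:R * Enum a (n - 2 * k).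
Proof.
case: n => // n _; rewrite {1}/Enum [Eseq a n.+1]/= nth_rcons size_Eseq ltnn eqxx.
congr (_ * _); apply: eq_big_nat => k /andP[k_gt0 _].
rewrite nth_Eseq // -ltnS; apply: (leq_trans (n := n.+1 - 0)) => //.
by rewrite ltn_sub2l // muln_gt0.
Qed.

Lemma Epoly_horner (R : realType) (a x : R) n :
  (Epoly a n).[x] = \sum_(0 <= k < n.+1) 'C(n, k)%:R * Enum a k * x ^+ (n - k).
Proof. by rewrite /Epoly horner_sum; apply: eq_bigr => k _; rewrite hornerZ hornerXn. Qed.

(* Main.v *)
(** Binomial convolution is the product of exponential generating functions.
    The first transform has kernel e^{-xt} (1 - a + a cosh t); the recurrence
    for E_{n,a} says that its generating function is 1 / (1 - a + a cosh t), so
    that of E_{n,a}(x) is e^{xt} / (1 - a + a cosh t), and the two kernels are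
    mutually inverse. *)

Require Import Defs.
From HB Require Import structures.
From mathcomp Require Import all_boot all_order all_algebra.
From mathcomp Require Import reals.
From mathcomp Require Import complex.
From mathcomp Require Import ring.

Import Order.TTheory GRing.Theory Num.Theory.
Local Open Scope ring_scope.
Local Open Scope complex_scope.

(** The summand is bracketed as in the transforms of the theorem, so that these are instances of
    [binconv] by conversion. *)
Definition binconv {F : pzSemiRingType} (u v : nat -> F) (n : nat) : F :=
  \sum_(0 <= k < n.+1) 'C(n, k)%:R * u k * v (n - k)%N.

(* The unit of [binconv]: the exponential generating function 1. *)
Definition binunit {F : pzSemiRingType} (n : nat) : F := (n == 0%N)%:R.

Lemma eq_binconv {F : pzSemiRingType} (u u' v v' : nat -> F) :
  u =1 u' -> v =1 v' -> binconv u v =1 binconv u' v'.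
Proof. by move=> eu ev n; apply: eq_bigr => k _; rewrite eu ev. Qed.

Lemma rmorph_binconv {F K : pzSemiRingType} (f : {rmorphism F -> K})
    (u v : nat -> F) n :
  f (binconv u v n) = binconv (f \o u) (f \o v) n.
Proof.
by rewrite /binconv rmorph_sum; apply: eq_bigr => k _; rewrite !rmorphM rmorph_nat.
Qed.

Lemma binconv1l {F : pzSemiRingType} (u : nat -> F) : binconv binunit u =1 u.
Proof.
move=> n; rewrite /binconv big_nat_recl // bin0 subn0 /binunit eqxx !mul1r.
by rewrite big1 ?addr0 // => k _; rewrite mulr0 mul0r.
Qed.

Lemma binconvC {F : comPzSemiRingType} (u v : nat -> F) :
  binconv u v =1 binconv v u.
Proof.
move=> n; rewrite /binconv big_nat_rev; apply: eq_big_nat => k /andP[_].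
by rewrite ltnS => kn; rewrite add0n subSS bin_sub // subKn // mulrAC.
Qed.

(** The binomial theorem, read as e^{yt} e^{zt} = e^{(y+z)t}. *)
Lemma binconv_exp {F : comPzSemiRingType} (y z : F) :
  binconv (fun n => y ^+ n) (fun n => z ^+ n) =1 (fun n => (y + z) ^+ n).
Proof.
move=> n; rewrite addrC exprDn /binconv big_mkord; apply: eq_bigr => k _.
by rewrite -mulrA mulr_natl mulrC.
Qed.

(* Truncated exponential generating function. *)
Definition egf {F : fieldType} (N : nat) (u : nat -> F) : {poly F} :=
  \poly_(i < N) (u i / i`!%:R).

(** Truncation at [N] does not affect coefficients below [N], and C(n,k) / n! = 1 / (k! (n-k)!). *)
Lemma coef_egfM {F : numFieldType} N (u v : nat -> F) n : (n < N)%N ->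
  (egf N u * egf N v)`_n = binconv u v n / n`!%:R.
Proof.
move=> nN; rewrite coefM /binconv big_mkord mulr_suml; apply: eq_bigr => k _.
have kn : (k <= n)%N by rewrite -ltnS.
rewrite !coef_poly (leq_ltn_trans kn nN) (leq_ltn_trans (leq_subr k n) nN).
have fact_neq0 m : m`!%:R != 0 :> F by rewrite pnatr_eq0 -lt0n fact_gt0.
rewrite -(bin_fact kn) !natrM.
have bin_neq0 : 'C(n, k)%:R != 0 :> F by rewrite pnatr_eq0 -lt0n bin_gt0.
by field; rewrite !fact_neq0.
Qed.

(** Inherited from polynomial multiplication: coefficient [n] of a product depends only on
    coefficients of degree at most [n], where the truncated series of a convolution agrees with the
    product of the truncated series. *)
Lemma binconvA {F : numFieldType} (u v w : nat -> F) :
  binconv u (binconv v w) =1 binconv (binconv u v) w.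
Proof.
have coef_egf N s k : (k < N)%N -> (egf N s)`_k = s k / k`!%:R :> F.
  by move=> kN; rewrite coef_poly kN.
move=> n; have fn : n`!%:R != 0 :> F by rewrite pnatr_eq0 -lt0n fact_gt0.
apply: (mulIf (invr_neq0 fn)); rewrite -!(coef_egfM n.+1) //.
transitivity ((egf n.+1 u * (egf n.+1 v * egf n.+1 w))`_n).
  rewrite !coefM; apply: eq_bigr => k _.
  congr (_ * _); have nkn : (n - k < n.+1)%N by rewrite ltnS leq_subr.
  by rewrite coef_egf // coef_egfM.
rewrite mulrA !coefM; apply: eq_bigr => k _.
by rewrite [in RHS]coef_egf // coef_egfM.
Qed.

(** Convolving with the inverse kernel cancels the kernel; commutativity makes the inverse
    two-sided, which gives the other direction. *)
Lemma binconv_inversion {F : numFieldType} (u v a_ b_ : nat -> F) :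
  binconv u v =1 binunit ->
  (b_ =1 binconv u a_) <-> (a_ =1 binconv v b_).
Proof.
have cancel (s t c d : nat -> F) :
    binconv s t =1 binunit -> d =1 binconv t c -> c =1 binconv s d.
  move=> st dE n; rewrite (eq_binconv _ _ _ _ (frefl s) dE) binconvA.
  by rewrite (eq_binconv _ _ _ _ st (frefl c)) binconv1l.
move=> uv; split; last exact: cancel.
by apply: cancel => n; rewrite binconvC.
Qed.

(** Links a convolution with an even kernel to the recurrence for [Enum], which is indexed by half
    the even index. *)
Lemma sum_nat_even {V : nmodType} (f : nat -> V) n :
  \sum_(0 <= k < n.+1 | ~~ odd k) f k = \sum_(0 <= k < n./2.+1) f (2 * k)%N.
Proof.
elim: n => [|n IHn]; first by rewrite big_mkcond !big_nat1.
rewrite big_mkcond big_nat_recr //= -big_mkcond IHn /= negbK uphalf_half.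
case: ifP => on; last by rewrite addr0.
rewrite add1n [RHS]big_nat_recr //=; congr (_ + f _).
by rewrite mulnS mul2n -[in LHS](odd_double_half n) on.
Qed.

(* Coefficients of 1 - a + a cosh t. *)
Definition cosh_kernel {F : fieldType} (a : F) (n : nat) : F :=
  (1 - a) * 0 ^+ n + a / 2 * (1 ^+ n + (- 1) ^+ n).

Lemma cosh_kernel0 {F : numFieldType} (a : F) : cosh_kernel a 0 = 1.
Proof. by rewrite /cosh_kernel !expr0; field. Qed.

Lemma cosh_kernelS {F : numFieldType} (a : F) n :
  cosh_kernel a n.+1 = if odd n.+1 then 0 else a.
Proof.
rewrite /cosh_kernel expr0n expr1n -signr_odd mulr0 add0r.
by case: (odd _); rewrite ?expr0 ?expr1; field.
Qed.

(** For positive index the term k = 0 is E_{n,a}, the odd terms vanish, and the remaining even ones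
    carry the factor a: the recurrence makes the total zero. *)
Lemma cosh_kernel_Enum (R : realType) (a : R) :
  binconv (cosh_kernel a) (Enum a) =1 binunit.
Proof.
case=> [|n]; first by rewrite /binconv big_nat1 cosh_kernel0 bin0 !mul1r.
pose f k := 'C(n.+1, k)%:R * Enum a (n.+1 - k).
have fE : \sum_(0 <= k < n.+1) (if odd k.+1 then 0 else f k.+1) =
          \sum_(1 <= k < n.+1./2.+1) f (2 * k)%N.
  (* The term [f 0] is split off both sums and cancelled. *)
  have := sum_nat_even f n.+1; rewrite big_mkcond big_nat_recl //.
  rewrite [RHS]big_ltn //= => /addrI <-.
  by apply: eq_bigr => k _; case: (odd k).
rewrite /binconv big_nat_recl // cosh_kernel0 bin0 !mul1r subn0 Enum_rec //.
rewrite -fE mulr_sumr -big_split big1 // => k _ /=.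
by rewrite cosh_kernelS /f /=; case: (odd k) => /=; ring.
Qed.

Lemma binconv_exp_cosh_kernel {F : numFieldType} (a x : F) :
  binconv (fun n => (- x) ^+ n) (cosh_kernel a) =1
  (fun n => (1 - a) * (- x) ^+ n
            + a / 2 * ((1 - x) ^+ n + (- 1 - x) ^+ n)).
Proof.
(* The cosh kernel combines e^{0t}, e^{t} and e^{-t}; each base on the right is written as -x plus
   0, 1 or -1. *)
move=> n; rewrite -{2}[- x]addr0 [1 - x]addrC [- 1 - x]addrC -!binconv_exp.
rewrite /binconv -big_split !mulr_sumr -big_split; apply: eq_bigr => k _ /=.
by rewrite /cosh_kernel; ring.
Qed.

Lemma binconv_Enum_exp (R : realType) (a x : R) :
  binconv (Enum a) (fun n => x ^+ n) =1 (fun n => (Epoly a n).[x]).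
Proof. by move=> n; rewrite Epoly_horner. Qed.

Lemma kernels_inverse (R : realType) (a x : R) :
  binconv (fun n => (1 - a) * (- x) ^+ n
                    + a / 2 * ((1 - x) ^+ n + (- 1 - x) ^+ n))
          (fun n => (Epoly a n).[x]) =1 binunit.
Proof.
move=> n; rewrite -(eq_binconv _ _ _ _ (binconv_exp_cosh_kernel a x)
                      (binconv_Enum_exp R a x)).
(* Regroup as e^{-xt} ((C E) e^{xt}), with C the cosh kernel and E the series of [Enum a], so that C
   E collapses to 1. *)
rewrite -binconvA (eq_binconv _ _ _ _ (frefl _) (binconvA _ _ _)).
rewrite (eq_binconv _ _ _ _ (frefl _)
           (eq_binconv _ _ _ _ (cosh_kernel_Enum R a) (frefl _))).
rewrite (eq_binconv _ _ _ _ (frefl _) (binconv1l _)) binconv_exp addNr.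
exact: expr0n.
Qed.

Theorem theorem2p7 (R : realType) (a x : R) :
  (forall a_ b_ : nat -> R,
     (forall n : nat,
        b_ n = \sum_(0 <= k < n.+1)
                 'C(n, k)%:R
                 * ((1 - a) * (- x) ^+ k
                    + a / 2 * ((1 - x) ^+ k + (- 1 - x) ^+ k))
                 * a_ (n - k)%N)
     <->
     (forall n : nat,
        a_ n = \sum_(0 <= k < n.+1)
                 'C(n, k)%:R * (Epoly a k).[x] * b_ (n - k)%N))
  /\
  (forall a_ b_ : nat -> R[i],
     (forall n : nat,
        b_ n = \sum_(0 <= k < n.+1)
                 'C(n, k)%:R
                 * ((1 - a) * (- x) ^+ k
                    + a / 2 * ((1 - x) ^+ k + (- 1 - x) ^+ k))%:C
                 * a_ (n - k)%N)
     <->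
     (forall n : nat,
        a_ n = \sum_(0 <= k < n.+1)
                 'C(n, k)%:R * ((Epoly a k).[x])%:C * b_ (n - k)%N)).
Proof.
split=> a_ b_; apply: binconv_inversion => n; first exact: kernels_inverse.
(* For complex sequences the kernels are still real: their inverse relation is transported along the
   embedding of [R] into [R[i]]. *)
rewrite -(rmorph_binconv (real_complex R)) kernels_inverse.
exact: rmorph_nat.
Qed.
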